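(* Let $T$ be the real vector space of traceless Hermitian matrices in $M_2(\mathbb C)$, let $\sigma^0$ be the $2\times2$ identity matrix, let $\mathcal I$ be the set of isocones (strong or weak: the statement holds for either notion) of $M_2(\mathbb C)$, and let $\Gamma$ be the set of closed convex cones with non-empty interior in $T\simeq\mathbb R^3$. Then the map $\phi:\mathcal I\to\Gamma$, $\phi(I)=I\cap T$, is a bijection, with $\phi^{-1}$ given by $C\mapsto C+\mathbb R\sigma^0$.
   Context: For a unital $C^*$-algebra $A$, let $\mathrm{Re}\,A=\{a\in A: a=a^*\}$, $|a|=\sqrt{a^*a}$, and for $a,b\in\mathrm{Re}\,A$ put $a\wedge b=\frac{a+b}{2}-\frac{|a-b|}{2}$, $a\vee b=\frac{a+b}{2}+\frac{|a-b|}{2}$. A strong (resp. weak) isocone of $A$ is a norm-closed subset $I\subset\mathrm{Re}\,A$ stable under addition and under multiplication by reals $\lambda\ge0$, containing $x1$ for all $x\in\mathbb R$, such that $b\wedge b',b\vee b'\in I$ for all $b,b'\in I$ (resp. for all $b,b'\in I$ with $bb'=b'b$), and whose complex linear span is dense in $A$. A convex cone is a non-empty subset stable under addition and multiplication by non-negative reals; ''interior'' is relative to $T$. *)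

(* Defs.v *)
From HB Require Import structures.
From mathcomp Require Import all_boot all_order all_algebra.
From mathcomp Require Import complex.
From mathcomp Require Import all_classical all_reals all_analysis.

Set Implicit Arguments.
Unset Strict Implicit.
Unset Printing Implicit Defensive.

Import Order.TTheory GRing.Theory Num.Theory.
Import numFieldNormedType.Exports.

Local Open Scope classical_set_scope.
Local Open Scope ring_scope.
Local Open Scope complex_scope.
Local Open Scope sesquilinear_scope.

(* The usual topology and norm of the complex plane. Through it 'M[R[i]]_n is a
   normedModType for the entrywise maximum norm; as 'M[R[i]]_n is finite
   dimensional, this norm is equivalent to its C*-norm, so that [closed],
   [dense] and [interior] below are those of the C*-norm. *)
HB.instance Definition _ (R : realType) := NormedModule.copy R[i] (R[i])^o.

Section Isocones.
Variables (R : realType) (n : nat).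
Local Notation M := 'M[R[i]]_n.
Implicit Types (a b p : M) (I : set M).

Definition selfadjoint : set M := [set a | a = a^t*].

Definition positive : set M := [set a | exists b, a = b^t* *m b].

(* The positive square root, which exists and is unique for positive [a];
   [0] is a dummy value for the other matrices. *)
Definition sqrtmx a : M := xget 0 [set p | positive p /\ p *m p = a].

Definition absmx a : M := sqrtmx (a^t* *m a).

Definition meetmx a b : M := 2^-1 *: (a + b) - 2^-1 *: absmx (a - b).
Definition joinmx a b : M := 2^-1 *: (a + b) + 2^-1 *: absmx (a - b).

Definition complex_span I : set M :=
  [set a | exists (m : nat) (c : 'I_m -> R[i]) (b : 'I_m -> M),
     (forall i, I (b i)) /\ a = \sum_(i < m) c i *: b i].

Variant isocone_kind := Strong | Weak.

Definition lattice_compatible (k : isocone_kind) b b' : Prop :=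
  match k with Strong => True | Weak => b *m b' = b' *m b end.

Record isocone (k : isocone_kind) I : Prop := Isocone {
  isocone_selfadjoint : I `<=` selfadjoint;
  isocone_closed : closed I;
  isocone_add : forall b b', I b -> I b' -> I (b + b');
  isocone_scale : forall (l : R) b, 0 <= l -> I b -> I (l%:C *: b);
  isocone_const : forall x : R, I (x%:C *: 1%:M);
  isocone_lattice : forall b b', I b -> I b' -> lattice_compatible k b b' ->
    I (meetmx b b') /\ I (joinmx b b');
  isocone_dense : dense (complex_span I) }.

Definition traceless_selfadjoint : set M :=
  [set a | selfadjoint a /\ \tr a = 0].

(* [subspace traceless_selfadjoint] carries the topology for which, on subsets
   of [traceless_selfadjoint], closedness and interior are the relative ones. *)
Record solid_closed_cone (C : set M) : Prop := SolidClosedCone {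
  cone_traceless : C `<=` traceless_selfadjoint;
  cone_nonempty : C !=set0;
  cone_add : forall c c', C c -> C c' -> C (c + c');
  cone_scale : forall (l : R) c, 0 <= l -> C c -> C (l%:C *: c);
  cone_closed : @closed (subspace traceless_selfadjoint) C;
  cone_interior : @interior (subspace traceless_selfadjoint) C !=set0 }.

Definition traceless_part I : set M := I `&` traceless_selfadjoint.

Definition add_scalars (C : set M) : set M :=
  [set c + x%:C *: 1%:M | c in C & x in [set: R]].

End Isocones.

(* Main.v *)
Require Import Defs.
From mathcomp Require Import all_boot all_order all_algebra.
From mathcomp Require Import complex ring.
From mathcomp Require Import all_classical all_reals all_analysis.
Import Order.TTheory GRing.Theory Num.Theory.
Import numFieldNormedType.Exports.
Local Open Scope classical_set_scope.
Local Open Scope ring_scope.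
Local Open Scope sesquilinear_scope.

Set Implicit Arguments.
Unset Strict Implicit.
Unset Printing Implicit Defensive.

(** Every Hermitian matrix splits uniquely as a traceless part plus a real
    multiple of the identity, and both splitting maps are continuous. An isocone
    I contains the real scalars, so it is the preimage of its traceless part
    under this splitting (traceless_partK), and the same description of
    C + R 1 (add_scalarsE) gives back C (add_scalarsK). What remains
    is to match density of the complex span with non-empty interior, and to see
    that C + R 1 satisfies the lattice condition.

    The first point holds in every dimension. If the span of I is
    dense, no nonzero linear form vanishes on I, since such a form is continuous
    and its kernel would be closed and proper. So I contains a complex basis
    of the matrix space. Hermitian matrices have real coordinates in a basis of
    Hermitian matrices, and near the sum of the basis vectors these coordinates
    are positive; a cone therefore contains all Hermitian matrices near that
    sum (real_cone_selfadjoint_interior), and translating by a scalar brings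
    the open set into the traceless matrices (traceless_part_cone). Conversely,
    if c is interior to C, every traceless Hermitian t is a real combination of
    c and of c + e t for small e > 0, both in C; so the real span of C + R 1
    is the space of all Hermitian matrices, and its complex span is everything
    (complex_span_add_scalars).

    The lattice condition is where dimension 2 enters. A traceless u satisfies
    u^2 = - det u, and from this the absolute value of a Hermitian h is
    z + w h with z, w real and |w| <= 1 (absmx_affine). Hence the meet of b and
    b' is (1 - w)/2 b + (1 + w)/2 b' plus a real scalar, and likewise for the
    join: a combination with nonnegative coefficients, which stays in the cone
    whether or not b and b' commute (meetjoin_in_cone). This is why the strong
    and the weak notion give the same result. *)

(** * Bases chosen in a set of vectors *)

(** Independent rows are added one at a time: as long as there are fewer than
    [n] of them, the cokernel of the matrix built so far is nonzero, and its
    columns would annihilate [X] if [X] were contained in the row space. *)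
Lemma unitmx_rows_in (K : fieldType) n (X : set 'rV[K]_n) :
  (forall v : 'cV_n, (forall u, X u -> u *m v = 0) -> v = 0) ->
  exists2 A : 'M[K]_n, A \in unitmx & forall i, X (row i A).
Proof.
move=> annX.
suff H k : (k <= n)%N ->
    exists2 A : 'M[K]_(k, n), row_free A & forall i, X (row i A).
  by have [A Afree XA] := H n (leqnn n); exists A; rewrite -?row_free_unit.
elim: k => [_|k IHk lt_kn].
  by exists 0 => [|[]//]; rewrite /row_free mxrank0.
have [A Afree XA] := IHk (ltnW lt_kn).
have [u Xu uNA] : exists2 u, X u & ~~ (u <= A)%MS.
  apply: contrapT => noX.
  have coker0 : cokermx A = 0.
    apply/matrixP => i j.
    suff /matrixP/(_ i 0) : col j (cokermx A) = 0 by rewrite !mxE.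
    apply: annX => u Xu; rewrite colE mulmxA.
    have : (u <= A)%MS.
      by apply: contrapT => uA; apply: noX; exists u => //; apply/negP.
    by rewrite submxE => /eqP ->; rewrite mul0mx.
  move: (mxrank_coker A); rewrite coker0 mxrank0 (eqP Afree) => /esym/eqP.
  by rewrite subn_eq0 leqNgt lt_kn.
have rowX (i : 'I_(1 + k)) : X (row i (col_mx u A)).
  case: (split_ordP i) => j ->; last by rewrite rowKd.
  by rewrite rowKu (_ : row j u = u) //; apply/rowP => l; rewrite !mxE ord1.
exists (col_mx u A : 'M[K]_(1 + k, n)) => //.
  rewrite /row_free eqn_leq rank_leq_row /= -(addsmxE u A).1.
  rewrite -[X in (X < _)%N](eqP Afree).
  apply: rank_ltmx; rewrite /ltmx addsmxSr /=.
  by apply: contra uNA; apply: submx_trans; rewrite addsmxSl.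
Qed.

(** * Continuity of matrix functionals, and Hermitian matrices *)

Section Selfadjoint.
Context {R : realType} {n : nat}.
Local Notation K := R[i].
Local Notation M := 'M[K]_n.
Implicit Types (a b : M).

Lemma adjmxD a b : (a + b)^t* = a^t* + b^t*.
Proof. by rewrite linearD map_mxD. Qed.

Lemma adjmxZ (c : K) a : (c *: a)^t* = c^* *: a^t*.
Proof. by rewrite linearZ map_mxZ. Qed.

Lemma adjmxN a : (- a)^t* = - a^t*.
Proof. by rewrite linearN map_mxN. Qed.

(** All linear forms on matrices, and all coordinates in a basis of the matrix
    space, are of this shape. *)
Lemma mxvec_mul_continuous p (B : 'M[K]_(n * n, p)) i j :
  continuous (fun a => (mxvec a *m B) i j).
Proof.
rewrite (_ : (fun a => _) = fun a => \sum_k mxvec a i k * B k j); last first.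
  by apply/funext => a; rewrite mxE.
apply: continuous_big => [|k _]; first exact: add_continuous.
case/mxvec_indexP: k => k l a; rewrite ord1.
rewrite (_ : (fun a => _) = fun a => a k l * B (mxvec_index k l) j); last first.
  by apply/funext => a'; rewrite mxvecE.
apply: (@continuousM K M (fun a => a k l)); first exact: coord_continuous.
exact: cst_continuous.
Qed.

Lemma mxtrace_continuous : continuous (fun a : M => \tr a).
Proof.
apply: continuous_big => [|k _]; first exact: add_continuous.
exact: coord_continuous.
Qed.

Lemma conjC_continuous : continuous (fun z : K => z^*).
Proof.
move=> z A /(@nbhs_ballP K K)[e e0 zA]; apply/(@nbhs_ballP K K).
exists e => // w; rewrite -ball_normE /= => zw; apply: zA.
by rewrite -ball_normE /= -rmorphB norm_conjC.
Qed.

Lemma selfadjoint_closed : closed (@selfadjoint R n).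
Proof.
rewrite (_ : @selfadjoint R n =
  \bigcap_(ij in [set: 'I_n * 'I_n])
    [set a : M | a ij.1 ij.2 - (a ij.2 ij.1)^* = 0]); last first.
  apply/seteqP; split => [a /= sa [i j] _ /=|a /= sa].
    by rewrite {1}sa !mxE subrr.
  apply/matrixP => i j; rewrite !mxE; apply/eqP.
  by rewrite -subr_eq0 (sa (i, j)).
apply: closed_bigI => -[i j] _ /=.
apply: (@preimage_closed _ _ (fun a : M => a i j - (a j i)^*) [set 0]).
  move=> a _.
  apply: (@continuousB K K M (fun a => a i j) (fun a => (a j i)^* )).
    exact: coord_continuous.
  exact: continuous_comp (@coord_continuous _ _ _ _ _ _) (@conjC_continuous _).
exact/accessible_closed_set1/hausdorff_accessible/norm_hausdorff.
Qed.

End Selfadjoint.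

(** * Density of the complex span and interior among Hermitian matrices *)

Lemma dense_sub_closed (T : topologicalType) (S F : set T) :
  dense S -> closed F -> S `<=` F -> F = setT.
Proof.
move=> dS cF SF; apply/seteqP; split=> // x _; apply: contrapT => nFx.
have [y [nFy Sy]] : ~` F `&` S !=set0.
  by apply: dS; [exists x|exact: closed_openC].
exact/nFy/SF.
Qed.

Section Span.
Context {R : realType} {n : nat}.
Local Notation K := R[i].
Local Notation M := 'M[K]_n.
Implicit Types (a b : M) (I : set M).

Lemma complex_span_sub I : I `<=` complex_span I.
Proof.
move=> a Ia; exists 1%N, (fun=> 1), (fun=> a); split=> //.
by rewrite big_ord1 scale1r.
Qed.

Lemma complex_spanZ I (c : K) a : complex_span I a -> complex_span I (c *: a).
Proof.
move=> [m [d [b [Ib ->]]]]; exists m, (fun i => c * d i), b; split=> //.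
by rewrite scaler_sumr; apply: eq_bigr => i _; rewrite scalerA.
Qed.

Lemma complex_spanD I a b :
  complex_span I a -> complex_span I b -> complex_span I (a + b).
Proof.
move=> [m [c [f [If ->]]]] [m' [c' [f' [If' ->]]]].
pose glue T (g : 'I_m -> T) (g' : 'I_m' -> T) (i : 'I_(m + m')) :=
  match fintype.split i with inl j => g j | inr j => g' j end.
exists (m + m')%N, (glue _ c c'), (glue _ f f'); split=> [i|].
  by rewrite /glue; case: fintype.split.
rewrite big_split_ord; congr (_ + _); apply: eq_bigr => i _.
  by rewrite /glue (unsplitK (inl i)).
by rewrite /glue (unsplitK (inr i)).
Qed.

(** A linear form vanishing on [I] vanishes on the complex span, hence on its
    closure by continuity; so density leaves only the zero form. *)
Lemma dense_span_unitmx_rows I : dense (complex_span I) ->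
  exists2 A : 'M[K]_(n * n), A \in unitmx & forall i, I (vec_mx (row i A)).
Proof.
move=> dI; apply: (@unitmx_rows_in K (n * n) [set u | I (vec_mx u)]) => v annv.
have F_T : [set a : M | (mxvec a *m v) 0 0 = 0] = setT.
  apply: dense_sub_closed dI _ _.
    apply: (@preimage_closed _ _ (fun a : M => (mxvec a *m v) 0 0) [set 0]).
      by move=> a _; exact: mxvec_mul_continuous.
    exact/accessible_closed_set1/hausdorff_accessible/norm_hausdorff.
  move=> _ [m [c [b [Ib ->]]]] /=; rewrite linear_sum mulmx_suml summxE big1 //.
  move=> i _; rewrite linearZ -scalemxAl annv ?scaler0 ?mxE //=.
  by rewrite mxvecK.
apply/colP => i; rewrite mxE.
have : [set a : M | (mxvec a *m v) 0 0 = 0] (vec_mx 'e_i) by rewrite F_T.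
by rewrite /= vec_mxK -rowE mxE.
Qed.

(** Taking adjoints fixes [a] and the basis matrices and conjugates the
    coordinates, which are unique. *)
Lemma selfadjoint_coord_real (A : 'M[K]_(n * n)) a i :
  A \in unitmx -> (forall j, selfadjoint (vec_mx (row j A))) ->
  selfadjoint a -> (mxvec a *m invmx A) 0 i \is Num.real.
Proof.
move=> Au sA sa; set y := mxvec a *m invmx A.
have yA : y *m A = mxvec a by rewrite mulmxKV.
suff yE : map_mx Num.conj y = y.
  by apply/CrealP; move/rowP: yE => /(_ i); rewrite mxE.
suff yA' : map_mx Num.conj y *m A = mxvec a by rewrite -[LHS](mulmxK Au) yA'.
have aE : a = \sum_j y 0 j *: vec_mx (row j A).
  rewrite -[LHS]mxvecK -yA mulmx_sum_row linear_sum.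
  by apply: eq_bigr => j _; rewrite linearZ.
rewrite mulmx_sum_row [in RHS]sa [in RHS]aE.
rewrite linear_sum map_mx_sum linear_sum; apply: eq_bigr => j _ /=.
by rewrite adjmxZ -(sA j) linearZ /= vec_mxK mxE.
Qed.

(** The scalars are complex numbers, nonnegative for the partial order of [K]
    and hence real, so that coordinates can be used without conversion. *)
Definition real_cone (I : set M) :=
  [/\ I 0, forall b b', I b -> I b' -> I (b + b')
    & forall (z : K) b, 0 <= z -> I b -> I (z *: b)].

Lemma real_coneP I : I 0 ->
  (forall b b', I b -> I b' -> I (b + b')) ->
  (forall (l : R) b, 0 <= l -> I b -> I (l%:C%C *: b)) -> real_cone I.
Proof.
move=> I0 ID IZ; split=> // z b z0; rewrite -(RRe_real (ger0_real z0)).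
by apply: IZ; rewrite -lecR (RRe_real (ger0_real z0)).
Qed.

(** The interior point is the sum of a basis contained in the cone: its
    coordinates are all 1, so those of a nearby Hermitian matrix are real and
    positive. *)
Lemma real_cone_selfadjoint_interior I :
  real_cone I -> I `<=` @selfadjoint R n -> dense (complex_span I) ->
  exists2 b, I b & \forall a \near b, selfadjoint a -> I a.
Proof.
move=> [I0 ID IZ] sI /dense_span_unitmx_rows [A Au IA].
pose y a i := (mxvec a *m invmx A) 0 i.
have yE a : a = \sum_i y a i *: vec_mx (row i A).
  rewrite -[LHS]mxvecK -[mxvec a in LHS](mulmxKV Au) mulmx_sum_row linear_sum.
  by apply: eq_bigr => j _; rewrite linearZ.
have sum_in (c : 'I_(n * n) -> K) :
    (forall i, 0 <= c i) -> I (\sum_i c i *: vec_mx (row i A)).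
  by move=> c0; apply: (big_ind I) => // i _; apply: IZ.
pose b := vec_mx (const_mx 1 *m A) : M.
have yb i : y b i = 1.
  by rewrite /y /b vec_mxK mulmxK // mxE.
exists b; first by rewrite (yE b); apply: sum_in => i; rewrite yb ler01.
have near_y : \forall a \near b, forall i, `|y b i - y a i| < 1.
  apply: (filter_forall (F := nbhs b)) => i.
  have := @mxvec_mul_continuous R n _ (invmx A) 0 i b.
  by move=> /(@cvgrPdist_lt _ K _ _ (nbhs_filter b)); apply.
apply: filterS near_y => a ya sa; rewrite (yE a); apply: sum_in => i.
have yr : y a i \is Num.real.
  by apply: selfadjoint_coord_real => // j; apply: sI.
have := ya i; rewrite yb real_ltr_norml ?rpredB ?rpred1 //.
by move=> /andP[_]; rewrite ltrBlDr ltrDl => /ltW.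
Qed.
End Span.

(** * Splitting off the trace *)

Section Tracefree.
Context {R : realType} {n : nat}.
Local Notation K := R[i].
Local Notation M := 'M[K]_n.+1.
Implicit Types (a b : M) (C I : set M).

Definition mean_trace a : K := n.+1%:R^-1 * \tr a.

Definition tracefree a : M := a - mean_trace a *: 1%:M.

Lemma tracefreeK a : tracefree a + mean_trace a *: 1%:M = a.
Proof. exact: subrK. Qed.

Lemma mean_traceD a b : mean_trace (a + b) = mean_trace a + mean_trace b.
Proof. by rewrite /mean_trace linearD mulrDr. Qed.

Lemma mean_traceZ (z : K) a : mean_trace (z *: a) = z * mean_trace a.
Proof. by rewrite /mean_trace linearZ mulrCA. Qed.

Lemma mean_trace1 : mean_trace 1%:M = 1.
Proof. by rewrite /mean_trace mxtrace1 mulVf // pnatr_eq0. Qed.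

Lemma mean_trace0 a : \tr a = 0 -> mean_trace a = 0.
Proof. by rewrite /mean_trace => ->; rewrite mulr0. Qed.

Lemma tracefreeD a b : tracefree (a + b) = tracefree a + tracefree b.
Proof. by rewrite /tracefree mean_traceD scalerDl opprD addrACA. Qed.

Lemma tracefreeZ (z : K) a : tracefree (z *: a) = z *: tracefree a.
Proof. by rewrite /tracefree mean_traceZ scalerBr scalerA. Qed.

Lemma tracefree_scalar (z : K) : tracefree (z *: 1%:M) = 0.
Proof. by rewrite /tracefree mean_traceZ mean_trace1 mulr1 subrr. Qed.

Lemma tracefree_id a : \tr a = 0 -> tracefree a = a.
Proof. by move=> /mean_trace0 m0; rewrite /tracefree m0 scale0r subr0. Qed.

Lemma mxtrace_tracefree a : \tr (tracefree a) = 0.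
Proof.
rewrite linearB /= linearZ /= mxtrace1 /mean_trace mulrAC.
by rewrite mulVf ?mul1r ?subrr ?pnatr_eq0.
Qed.

Lemma mean_trace_real a : selfadjoint a -> mean_trace a \is Num.real.
Proof.
move=> sa; rewrite /mean_trace realM ?realV ?realn //.
by apply/CrealP; rewrite [in RHS]sa -map_trmx mxtrace_tr trace_map_mx.
Qed.

Lemma selfadjointD a b : selfadjoint a -> selfadjoint b -> selfadjoint (a + b).
Proof. by rewrite /selfadjoint /= adjmxD => {1}-> {1}->. Qed.

Lemma selfadjointZ (z : K) a :
  z \is Num.real -> selfadjoint a -> selfadjoint (z *: a).
Proof. by rewrite /selfadjoint /= adjmxZ => /conj_Creal -> {1}->. Qed.

Lemma selfadjoint1 : selfadjoint (1%:M : M).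
Proof. by rewrite /selfadjoint /= trmx1 map_mx1. Qed.

Lemma selfadjoint0 : selfadjoint (0 : M).
Proof. by rewrite -(scale0r 1%:M); exact: selfadjointZ selfadjoint1. Qed.

Lemma selfadjointB a b : selfadjoint a -> selfadjoint b -> selfadjoint (a - b).
Proof.
move=> sa sb; rewrite -scaleN1r.
by apply/selfadjointD/selfadjointZ; rewrite ?realN.
Qed.

Lemma tracefree_selfadjoint a : selfadjoint a -> selfadjoint (tracefree a).
Proof.
move=> sa; apply: selfadjointB => //.
exact: selfadjointZ (mean_trace_real sa) selfadjoint1.
Qed.

Lemma tracefree_traceless a :
  selfadjoint a -> traceless_selfadjoint (tracefree a).
Proof.
by move=> sa; split; [exact: tracefree_selfadjoint|exact: mxtrace_tracefree].
Qed.

Lemma tracefree_continuous : continuous tracefree.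
Proof.
move=> a; apply: (@continuousB K M M id (fun a => mean_trace a *: 1%:M)).
  exact: cvg_id.
apply: (@continuousZ K M M mean_trace (fun=> 1%:M)); last exact: cst_continuous.
apply: (@continuousM K M (fun=> _) (fun a => \tr a)).
  exact: cst_continuous.
exact: mxtrace_continuous.
Qed.

Lemma add_scalarsE C : C `<=` @traceless_selfadjoint R n.+1 ->
  add_scalars C = [set a | selfadjoint a /\ C (tracefree a)].
Proof.
move=> CT; apply/seteqP; split=> [_ [c Cc [x _ <-]]|a [sa Ca]] /=.
  have [sc tc] := CT _ Cc; split.
    apply: selfadjointD => //; apply: selfadjointZ selfadjoint1.
    by rewrite complex_real.
  by rewrite tracefreeD tracefree_scalar addr0 tracefree_id.
exists (tracefree a) => //; exists (complex.Re (mean_trace a)) => //.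
by rewrite (RRe_real (mean_trace_real sa)) tracefreeK.
Qed.

Lemma solid_closed_cone0 C : solid_closed_cone C -> C 0.
Proof.
move=> sC; have [c Cc] := cone_nonempty sC.
by have := cone_scale sC (lexx 0) Cc; rewrite scale0r.
Qed.

Lemma traceless_selfadjoint_closed : closed (@traceless_selfadjoint R n.+1).
Proof.
apply: closedI; first exact: selfadjoint_closed.
apply: (@preimage_closed _ _ (fun a : M => \tr a) [set 0]).
  by move=> a _; exact: mxtrace_continuous.
exact/accessible_closed_set1/hausdorff_accessible/norm_hausdorff.
Qed.

(** * From isocones to cones *)

Lemma scalar_in_isocone k I (z : K) :
  isocone k I -> z \is Num.real -> I (z *: 1%:M).
Proof. by move=> iI /RRe_real <-; exact: isocone_const iI _. Qed.

Lemma isocone_real_cone k I : isocone k I -> real_cone I.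
Proof.
move=> iI; apply: real_coneP; [|exact: isocone_add iI|exact: isocone_scale iI].
by rewrite -(scale0r (1%:M : M)); apply: scalar_in_isocone iI _; rewrite rpred0.
Qed.

Lemma isocone_tracefree k I a : isocone k I -> I a -> I (tracefree a).
Proof.
move=> iI Ia; apply: (isocone_add iI) => //; rewrite -scaleNr.
apply: (scalar_in_isocone iI); rewrite realN; apply: mean_trace_real.
exact: (isocone_selfadjoint iI).
Qed.

(** For the interior: [I] contains the Hermitian matrices near some [b]. The
    translation by the scalar part of [b] carries the traceless matrices near
    the traceless part of [b] to such matrices, and scalars can then be
    subtracted inside [I]. *)
Lemma traceless_part_cone k I :
  isocone k I -> solid_closed_cone (traceless_part I).
Proof.
move=> iI; have [I0 ID IZ] := isocone_real_cone iI.
split.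
- by move=> a [].
- by exists 0; split=> //; split; [exact: selfadjoint0|exact: linear0].
- move=> c c' [Ic [sc tc]] [Ic' [sc' tc']]; split; first exact: ID.
  by split; [exact: selfadjointD|rewrite linearD /= tc tc' addr0].
- move=> l c l0 [Ic [sc tc]]; split; first exact: (isocone_scale iI).
  split; last by rewrite linearZ /= tc mulr0.
  by apply: selfadjointZ => //; rewrite complex_real.
- apply: closed_subspaceW; apply: closedI; first exact: isocone_closed iI.
  exact: traceless_selfadjoint_closed.
have [b Ib nbI] := real_cone_selfadjoint_interior (isocone_real_cone iI)
  (isocone_selfadjoint iI) (isocone_dense iI).
have Tb := tracefree_traceless (isocone_selfadjoint iI Ib).
exists (tracefree b).
suff : within (@traceless_selfadjoint R n.+1) (nbhs (tracefree b))
         (traceless_part I).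
  by rewrite nbhs_subspace_in.
pose m := mean_trace b *: 1%:M : M.
have shift_cts : continuous (fun t : M => t + m).
  move=> t; apply: (@continuousD K M M id (fun=> m)); first exact: cvg_id.
  exact: cst_continuous.
have := shift_cts (tracefree b) [set a | selfadjoint a -> I a].
rewrite tracefreeK => /(_ nbI).
apply: (@filterS _ (nbhs (tracefree b))) => t tI Tt; split=> //.
have mr : mean_trace b \is Num.real.
  exact/mean_trace_real/(isocone_selfadjoint iI).
have /(isocone_tracefree iI) : I (t + m).
  apply: tI; apply: selfadjointD; first by case: Tt.
  exact: selfadjointZ selfadjoint1.
by rewrite tracefreeD tracefree_scalar addr0 tracefree_id //; case: Tt.
Qed.

Lemma traceless_partK k I : isocone k I -> add_scalars (traceless_part I) = I.
Proof.
move=> iI; rewrite add_scalarsE; last by move=> a [].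
apply/seteqP; split=> [a [sa [Ia _]]|a Ia] /=.
  rewrite -(tracefreeK a); apply: (isocone_add iI) => //.
  exact: scalar_in_isocone iI (mean_trace_real sa).
have sa := isocone_selfadjoint iI Ia; split=> //; split.
  exact: isocone_tracefree iI Ia.
exact: tracefree_traceless.
Qed.

Lemma add_scalarsK C : C `<=` @traceless_selfadjoint R n.+1 ->
  traceless_part (add_scalars C) = C.
Proof.
move=> CT; rewrite add_scalarsE //.
apply/seteqP; split=> [a [[_ Ca] [_ ta]]|a Ca].
  by rewrite -(tracefree_id ta).
by have [sa ta] := CT _ Ca; do 2 split=> //; rewrite tracefree_id.
Qed.

(** * From cones to isocones *)

(** An interior point of the cone can be moved a little in every direction. *)
Lemma solid_cone_absorbing C : solid_closed_cone C ->
  exists2 c, C c & forall t, traceless_selfadjoint t ->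
    exists2 e : K, 0 < e & C (c + e *: t).
Proof.
move=> sC.
have [c iCc] : exists c : M,
    @interior (subspace (@traceless_selfadjoint R n.+1)) C c := cone_interior sC.
have Cc : C c by exact: (interior_subset iCc).
have Tc := cone_traceless sC Cc.
have nCc : within (@traceless_selfadjoint R n.+1) (nbhs (c : M)) C.
  by rewrite nbhs_subspace_in.
exists c => // t Tt.
have line_cts : continuous (fun z : K => c + z *: t).
  move=> z; apply: (@continuousD K M K (fun=> c) (fun z => z *: t)).
    exact: cst_continuous.
  apply: (@continuousZ K M K id (fun=> t)); first exact: cvg_id.
  exact: cst_continuous.
have := line_cts 0 [set a | traceless_selfadjoint a -> C a].
rewrite scale0r addr0 => /(_ nCc) /(@nbhs_ballP K K)[e /= e0 eC].
have e20 : 0 < e / 2 by rewrite divr_gt0.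
(* The ball is open, so its radius [e] itself could fall outside. *)
exists (e / 2) => //; apply: eC.
  rewrite -ball_normE /= sub0r normrN gtr0_norm //.
  by rewrite ltr_pdivrMr // mulr_natr mulr2n ltrDl.
have [[sc tc] [st tt]] := (Tc, Tt).
split; last by rewrite linearD /= linearZ /= tc tt mulr0 addr0.
by apply: selfadjointD => //; apply: selfadjointZ => //; exact: gtr0_real.
Qed.

(** The traceless part of a Hermitian [h] is, up to a factor, a difference of
    two elements of [C], and every matrix is a combination of the Hermitian matrices
    [a + a^t*] and ['i *: (a^t* - a)]. *)
Lemma complex_span_add_scalars C : solid_closed_cone C ->
  complex_span (add_scalars C) = setT.
Proof.
move=> sC; have CT := cone_traceless sC.
have sub := @complex_span_sub R n.+1 (add_scalars C).
have C0 := solid_closed_cone0 sC.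
have inC c : C c -> complex_span (add_scalars C) c.
  move=> Cc; apply: sub; rewrite add_scalarsE //=.
  by have [sc tc] := CT _ Cc; rewrite tracefree_id.
have scal z : complex_span (add_scalars C) (z *: 1%:M).
  apply/complex_spanZ/sub; rewrite add_scalarsE //; split.
    exact: selfadjoint1.
  by rewrite -(scale1r 1%:M) tracefree_scalar.
have [c Cc absC] := solid_cone_absorbing sC.
have sa_span h : selfadjoint h -> complex_span (add_scalars C) h.
  move=> sh; have [e e0 Ce] := absC _ (tracefree_traceless sh).
  rewrite -(tracefreeK h); apply: complex_spanD => //.
  have -> : tracefree h = e^-1 *: (c + e *: tracefree h) + (- e^-1) *: c.
    rewrite scalerDr scalerA mulVf ?gt_eqF // scale1r scaleNr.
    by rewrite addrAC subrr add0r.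
  by apply: complex_spanD; apply: complex_spanZ; apply: inC.
apply/seteqP; split=> // a _.
have -> : a = 2^-1 *: (a + a^t*) + (2^-1 * 'i) *: ('i *: (a^t* - a)).
  rewrite scalerA -mulrA -expr2 sqrCi mulrN1 scaleNr -scalerBr opprB addrACA.
  by rewrite subrr addr0 -mulr2n -(scaler_nat 2 a) scalerA mulVf ?scale1r
             ?pnatr_eq0.
apply: complex_spanD; apply/complex_spanZ/sa_span.
  by rewrite /selfadjoint /= adjmxD trmxCK addrC.
rewrite /selfadjoint /= adjmxZ adjmxD adjmxN trmxCK conjCi scaleNr -scalerN.
by rewrite opprB.
Qed.

End Tracefree.

(** * Two-by-two matrices *)

Section TwoByTwoRing.
Context {F : comNzRingType}.
Implicit Type (u : 'M[F]_2).

Lemma det_mx22 u : \det u = u 0 0 * u 1 1 - u 0 1 * u 1 0.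
Proof.
rewrite (expand_det_row _ 0) !big_ord_recl big_ord0 addr0 /cofactor !det_mx11.
rewrite !mxE /= !expr0 expr1 mul1r mulN1r mulrN.
by congr (u _ _ * u _ _ - u _ _ * u _ _); apply/val_inj.
Qed.

Lemma mxtrace22 u : \tr u = u 0 0 + u 1 1.
Proof.
rewrite /mxtrace !big_ord_recl big_ord0 addr0.
by congr (_ + u _ _); apply/val_inj.
Qed.

(** This is Cayley-Hamilton. *)
Lemma traceless_sqr22 u : \tr u = 0 -> u *m u = (- \det u) *: 1%:M.
Proof.
rewrite mxtrace22 addrC => /eqP; rewrite addr_eq0 => /eqP u11.
have E i j : (u *m u) i j = u i 0 * u 0 j + u i 1 * u 1 j.
  rewrite !mxE !big_ord_recl big_ord0 addr0.
  by congr (_ + u _ _ * u _ _); apply/val_inj.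
have ord2 (i : 'I_2) : i = 0 \/ i = 1.
  by case: i => [[|[|//]] ?]; [left|right]; apply/val_inj.
apply/matrixP => i j; rewrite E !mxE det_mx22 u11.
by case: (ord2 i) => ->; case: (ord2 j) => -> /=; rewrite ?u11; ring.
Qed.

Lemma det_scalarD_traceless22 (z : F) u :
  \tr u = 0 -> \det (z *: 1%:M + u) = z ^+ 2 + \det u.
Proof.
rewrite mxtrace22 addrC => /eqP; rewrite addr_eq0 => /eqP u11.
by rewrite !det_mx22 !mxE /= u11; ring.
Qed.

End TwoByTwoRing.

(** * The absolute value of a two-by-two Hermitian matrix *)

Section Modulus.
Context {R : realType}.
Local Notation K := R[i].

Lemma mxtrace_sqr_adj n (b : 'M[K]_n) :
  \tr (b^t* *m b) = \sum_j \sum_i `|b i j| ^+ 2.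
Proof.
apply: eq_bigr => j _; rewrite mxE; apply: eq_bigr => i _.
by rewrite !mxE normCKC.
Qed.

Lemma mxtrace_sqr_adj_ge0 n (b : 'M[K]_n) : 0 <= \tr (b^t* *m b).
Proof.
rewrite mxtrace_sqr_adj; apply: sumr_ge0 => j _; apply: sumr_ge0 => i _.
exact: exprn_ge0.
Qed.

Lemma mxtrace_sqr_adj_eq0 n (b : 'M[K]_n) : \tr (b^t* *m b) = 0 -> b = 0.
Proof.
rewrite mxtrace_sqr_adj => /eqP.
have sq_ge0 j : 0 <= \sum_i `|b i j| ^+ 2.
  by apply: sumr_ge0 => i _; exact: exprn_ge0.
rewrite psumr_eq0 // => /allP col0; apply/matrixP => i j; rewrite mxE.
have := col0 j (mem_index_enum _); rewrite psumr_eq0 => [/allP|k _]; last first.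
  exact: exprn_ge0.
move=> /(_ i (mem_index_enum _)) /=.
by rewrite sqrf_eq0 normr_eq0 => /eqP.
Qed.

Lemma det_sqr_adj_ge0 n (b : 'M[K]_n) : 0 <= \det (b^t* *m b).
Proof.
by rewrite det_mulmx -map_trmx det_tr det_map_mx -normCKC exprn_ge0.
Qed.

Lemma positive_selfadjoint n (p : 'M[K]_n) : positive p -> selfadjoint p.
Proof.
by move=> [b ->]; rewrite /selfadjoint /= trmx_mul map_mxM trmxCK.
Qed.

(** The pairs [(al ^+ 2, r)] and [(x ^+ 2, s)] have the same sum and the same
    product, so they agree up to order, and [al ^+ 2] is the larger element. *)
Lemma root_pair_bound (x s al r : K) :
  x \is Num.real -> 0 < al -> 0 <= r <= al ^+ 2 ->
  al ^+ 2 + r = x ^+ 2 + s -> al ^+ 2 * r = x ^+ 2 * s -> `|x / al| <= 1.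
Proof.
move=> xr al0 /andP[r0 r_al] sumE prodE.
rewrite normf_div (gtr0_norm al0) ler_pdivrMr // mul1r.
rewrite -(@ler_pXn2r _ 2) ?nnegrE ?(ltW al0) // real_normK //.
have : (al ^+ 2 - x ^+ 2) * (al ^+ 2 - s) = 0.
  have -> : (al ^+ 2 - x ^+ 2) * (al ^+ 2 - s) =
      al ^+ 2 * (al ^+ 2 + r - (x ^+ 2 + s)) - (al ^+ 2 * r - x ^+ 2 * s).
    by ring.
  by rewrite sumE prodE !subrr mulr0 subr0.
move=> /eqP; rewrite mulf_eq0 => /orP[|] /eqP/subr0_eq E.
  by rewrite E.
suff -> : x ^+ 2 = r by [].
by apply/esym/(addrI (al ^+ 2)); rewrite sumE -E addrC.
Qed.

(** Write [p = al + u] and [h = x + t] with [u], [t] traceless. As [u] and [t]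
    square to scalars, comparing scalar and traceless parts of the two squares
    gives [al * u = x * t] and equations in [al ^+ 2], [x ^+ 2] and the
    determinants of [u] and [t]. Positivity of [p] says that its eigenvalues
    are nonnegative, that is [0 <= al] and [- \det u <= al ^+ 2]; this selects
    the solution in which [x / al] has absolute value at most 1. *)
Lemma sqrtmx_affine (h : 'M[K]_2) (p : 'M[K]_2) :
  selfadjoint h -> positive p -> p *m p = h *m h ->
  exists z w : K, [/\ z \is Num.real, w \is Num.real, `|w| <= 1 &
    p = z *: 1%:M + w *: h].
Proof.
move=> sh pp pE; have sp := positive_selfadjoint pp.
set al := mean_trace p; set x := mean_trace h.
set u := tracefree p; set t := tracefree h.
have [tru trt] : \tr u = 0 /\ \tr t = 0 by split; exact: mxtrace_tracefree.
have [su st] : selfadjoint u /\ selfadjoint t.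
  by split; exact: tracefree_selfadjoint.
have xr : x \is Num.real by exact: mean_trace_real.
have al0 : 0 <= al.
  case: pp => b pb; rewrite /al /mean_trace pb.
  by rewrite mulr_ge0 ?invr_ge0 ?ler0n ?mxtrace_sqr_adj_ge0.
have pE' : p = al *: 1%:M + u by rewrite addrC tracefreeK.
have hE : h = x *: 1%:M + t by rewrite addrC tracefreeK.
(* A positive matrix of trace zero vanishes. *)
have p_eq0 : al = 0 -> p = 0.
  move=> al_eq0; case: pp => b pb.
  suff b0 : b = 0 by rewrite pb b0 mulmx0.
  apply: mxtrace_sqr_adj_eq0; rewrite -pb; apply/eqP.
  by move/eqP: al_eq0; rewrite /al /mean_trace mulf_eq0 invr_eq0 pnatr_eq0.
clearbody al x u t.
have sqrE (z : K) (v : 'M[K]_2) : \tr v = 0 ->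
    (z *: 1%:M + v) *m (z *: 1%:M + v) =
    (z ^+ 2 - \det v) *: 1%:M + (2 * z) *: v.
  move=> trv; rewrite mulmxDl !mulmxDr (traceless_sqr22 trv).
  rewrite -!scalemxAl -!scalemxAr !mul1mx !mulmx1 scalerA -expr2.
  by rewrite [z *: v + - _ *: _]addrC addrACA -!scalerDl -mulr2n mulr_natl.
have sqrs : (al ^+ 2 - \det u) *: 1%:M + (2 * al) *: u
          = (x ^+ 2 - \det t) *: 1%:M + (2 * x) *: t.
  by rewrite -!sqrE // -pE' -hE.
have sumE : al ^+ 2 - \det u = x ^+ 2 - \det t.
  have := congr1 (@mean_trace R 1) sqrs.
  rewrite !mean_traceD !mean_traceZ mean_trace1 !mean_trace0 //.
  by rewrite !mulr0 !addr0 !mulr1.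
have linE : al *: u = x *: t.
  move: sqrs; rewrite sumE => /addrI; rewrite -!scalerA.
  by apply: scalerI; rewrite pnatr_eq0.
have prodE : al ^+ 2 * - \det u = x ^+ 2 * - \det t.
  by rewrite !mulrN -!detZ linE.
have det_le0 (v : 'M[K]_2) : \tr v = 0 -> selfadjoint v -> 0 <= - \det v.
  move=> trv sv; have := mxtrace_sqr_adj_ge0 v.
  rewrite -sv traceless_sqr22 // linearZ /= mxtrace1.
  by rewrite pmulr_lge0 // ltr0n.
have det_p : 0 <= al ^+ 2 + \det u.
  rewrite -det_scalarD_traceless22 // -pE'.
  by case: pp => b ->; exact: det_sqr_adj_ge0.
have [al_eq0|al_neq0] := eqVneq al 0.
  exists 0, 0; split; rewrite ?rpred0 ?normr0 ?ler01 //.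
  by rewrite !scale0r addr0 p_eq0.
have al_gt0 : 0 < al by rewrite lt_def al_neq0.
exists (al - x / al * x), (x / al).
have wr : x / al \is Num.real by rewrite realM ?realV // gtr0_real.
split=> //.
- by apply: realB; [exact: gtr0_real|exact: realM].
- apply: (@root_pair_bound x (- \det t) al (- \det u)) => //.
  by rewrite det_le0 //= -subr_ge0 opprK.
have uE : u = (x / al) *: t.
  by rewrite mulrC -scalerA -linE scalerA mulVf // scale1r.
by rewrite [LHS]pE' uE [in RHS]hE scalerDr scalerA scalerBl addrA subrK.
Qed.

Lemma absmx_affine (h : 'M[K]_2) : selfadjoint h ->
  exists z w : K, [/\ z \is Num.real, w \is Num.real, `|w| <= 1 &
    absmx h = z *: 1%:M + w *: h].
Proof.
move=> sh; rewrite /absmx /sqrtmx; case: xgetP => [p _ [pp pE]|_].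
  by apply: sqrtmx_affine => //; rewrite pE -[in LHS]sh.
(* The dummy value of the square root is also of the required form. *)
exists 0, 0; split; rewrite ?rpred0 ?normr0 ?ler01 //.
by rewrite !scale0r addr0.
Qed.

(** With [e = - w] for the meet and [e = w] for the join, the result is
    [(1 + e) / 2 *: b + (1 - e) / 2 *: b'] up to a real scalar, and [|w| <= 1]
    makes both coefficients nonnegative. *)
Lemma meetjoin_in_cone (I : set 'M[K]_2) b b' : real_cone I ->
  I `<=` @selfadjoint R 2 -> (forall z : K, z \is Num.real -> I (z *: 1%:M)) ->
  I b -> I b' -> I (meetmx b b') /\ I (joinmx b b').
Proof.
move=> [I0 ID IZ] sI I1 Ib Ib'.
have [z [w [zr wr w1 absE]]] :=
  absmx_affine (selfadjointB (sI _ Ib) (sI _ Ib')).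
have /andP[Nw1 w1'] : -1 <= w <= 1 by rewrite -real_ler_norml.
have half_real : 2^-1 \is @Num.real K by rewrite realV realn.
have half_ge0 : 0 <= 2^-1 :> K by rewrite invr_ge0 ler0n.
have comb (e y : K) : -1 <= e <= 1 -> y \is Num.real ->
    I ((2^-1 * (1 + e)) *: b + (2^-1 * (1 - e)) *: b' + y *: 1%:M).
  move=> /andP[Ne1 e1] yr; apply: (ID _ _ _ (I1 _ yr)).
  apply: ID; apply: IZ => //.
    by rewrite mulr_ge0 // -lerBlDl sub0r.
  by rewrite mulr_ge0 // subr_ge0.
split.
  rewrite (_ : meetmx b b' = (2^-1 * (1 + - w)) *: b + (2^-1 * (1 - - w)) *: b'
                             + (- (2^-1 * z)) *: 1%:M).
    by apply: comb; [rewrite lerN2 lerNl Nw1 w1'|rewrite realN realM].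
  by rewrite /meetmx absE; apply/matrixP => i j; rewrite !mxE; ring.
rewrite (_ : joinmx b b' = (2^-1 * (1 + w)) *: b + (2^-1 * (1 - w)) *: b'
                           + (2^-1 * z) *: 1%:M).
  by apply: comb; [rewrite Nw1 w1'|rewrite realM].
by rewrite /joinmx absE; apply/matrixP => i j; rewrite !mxE; ring.
Qed.

(** Closedness: a relatively closed cone is the trace on the traceless matrices
    of a closed set [V], and [C + R 1] consists of the Hermitian matrices whose
    traceless part is in [V]. *)
Lemma add_scalars_isocone k (C : set 'M[K]_2) :
  solid_closed_cone C -> isocone k (add_scalars C).
Proof.
move=> sC; have CT := cone_traceless sC.
have C0 := solid_closed_cone0 sC.
have sI : add_scalars C `<=` @selfadjoint R 2.
  by rewrite add_scalarsE // => a [].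
have I1 (z : K) : z \is Num.real -> add_scalars C (z *: 1%:M).
  move=> zr; rewrite add_scalarsE //; split; last by rewrite tracefree_scalar.
  exact: selfadjointZ selfadjoint1.
have ID b b' : add_scalars C b -> add_scalars C b' -> add_scalars C (b + b').
  rewrite add_scalarsE // => -[sb Cb] [sb' Cb']; split.
    exact: selfadjointD.
  by rewrite tracefreeD; exact: cone_add sC _ _ Cb Cb'.
have IZ (l : R) b : 0 <= l -> add_scalars C b -> add_scalars C (l%:C%C *: b).
  rewrite add_scalarsE // => l0 [sb Cb]; split.
    by apply: selfadjointZ => //; rewrite complex_real.
  by rewrite tracefreeZ; exact: cone_scale sC _ _ l0 Cb.
have I_cone : real_cone (add_scalars C).
  apply: real_coneP => //; rewrite -(scale0r 1%:M).
  by apply: I1; rewrite rpred0.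
split => //.
- have [V cV VC] : exists2 V : set 'M[K]_2, closed V &
      V `&` @traceless_selfadjoint R 2 = C `&` @traceless_selfadjoint R 2.
    exact/closed_subspaceP/(cone_closed sC).
  rewrite (_ : add_scalars C = @selfadjoint R 2 `&` (@tracefree R 1 @^-1` V)).
    apply: closedI; first exact: selfadjoint_closed.
    by apply: preimage_closed => // a _; exact: tracefree_continuous.
  rewrite add_scalarsE //; apply/seteqP; split=> a [sa Ca]; split=> //=.
    have : (V `&` @traceless_selfadjoint R 2) (tracefree a).
      by rewrite VC; split=> //; exact: CT.
    by case.
  have : (C `&` @traceless_selfadjoint R 2) (tracefree a).
    by rewrite -VC; split=> //; exact: tracefree_traceless.
  by case.
- by move=> x; apply: I1; rewrite complex_real.
- by move=> b b' Ib Ib' _; exact: meetjoin_in_cone.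
- by rewrite complex_span_add_scalars // => O O0 _; rewrite setIT.
Qed.

End Modulus.

(** * The bijection *)

Theorem theorem37 (R : realType) (k : isocone_kind) :
  [/\ set_bij (@isocone R 2 k) (@solid_closed_cone R 2) (@traceless_part R 2),
      forall C : set 'M[R[i]]_2, solid_closed_cone C ->
        isocone k (add_scalars C) /\ traceless_part (add_scalars C) = C
    & forall I : set 'M[R[i]]_2, isocone k I ->
        add_scalars (traceless_part I) = I].
Proof.
have from_cone (C : set 'M[R[i]]_2) : solid_closed_cone C ->
    isocone k (add_scalars C) /\ traceless_part (add_scalars C) = C.
  move=> sC; split; first exact: add_scalars_isocone.
  exact/add_scalarsK/(cone_traceless sC).
have from_isocone (I : set 'M[R[i]]_2) :
    isocone k I -> add_scalars (traceless_part I) = I.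
  exact: traceless_partK.
split=> //; split.
- by move=> I; exact: traceless_part_cone.
- move=> I J; rewrite !inE => /from_isocone IE /from_isocone JE IJ.
  by rewrite -IE IJ.
- by move=> C /from_cone[iC CE]; exists (add_scalars C).
Qed.
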